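(* Let $A=\mathbb{Z}_{\ge h}$ for a fixed positive integer $h$ and let $f:A\to\mathbb{C}$ be an arbitrary function. Then $f$ has at most one asymptotic expansion of generalized Poincaré type with respect to a given asymptotic sequence (where equivalent expansions are identified). Moreover, the zero function has only the trivial asymptotic expansions of generalized Poincaré type.
   Context: A sequence of functions $\{\varphi_m:A\to\mathbb{C}\}_{m\ge0}$ is an asymptotic sequence (as $k\to\infty$) if $\varphi_{m+1}(k)=o(\varphi_m(k))$ as $k\to\infty$ for all $m\geq 0$ and, for each $m$, $\varphi_m(k)\ne0$ for all sufficiently large $k$. A function $f:A\to\mathbb{C}$ has an asymptotic expansion of generalized Poincaré type with respect to $\{\varphi_m\}$ if there are an integer $M\ge0$, numbers $q_j\in[0,1[$ and $c_m^j\in\mathbb{C}$ ($1\le j\le M$, $m\ge0$) such that for all integers $N\ge0$ $$f(k)=\Bigl[\sum_{j=1}^{M}e^{2\pi ikq_j}\sum_{m=0}^{N}c_m^j\varphi_m(k)\Bigr]+o(\varphi_N(k))\quad\text{as }k\to\infty.$$ The expansion is the data $(M,(q_j),(c_m^j))$. It is trivial if $c_m^j=0$ for all $j,m$ (this includes $M=0$). Two expansions are equivalent if one is obtained from the other by a finite sequence of the operations: (i) interchange two terms of $\sum_{j=1}^M$; (ii) remove or add a term with $c_m^j=0$ for all $m$; (iii) collect two terms with the same value $q_j$. An expansion is not distinguished from its equivalence class. An expansion is on minimal form if it has no term $j$ with $c_m^j=0$ for all $m$ and the $q_j$ are mutually different; each class has a unique representative on minimal form up to the order of summation. Thus the theorem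 says that if $f$ has an expansion on minimal form, then $M$ and the $q_j$ and $c_m^j$ are uniquely determined by $f$ (up to the order of the terms). *)

(* Defs.v *)
From Stdlib Require Import Relation_Operators.
From Stdlib Require List.
From mathcomp Require Import all_boot all_order all_algebra.
From mathcomp Require Import complex.
From mathcomp Require Import all_classical all_reals all_analysis.

Set Implicit Arguments.
Unset Strict Implicit.
Unset Printing Implicit Defensive.

Import Order.TTheory GRing.Theory Num.Theory numFieldNormedType.Exports.

Local Open Scope classical_set_scope.
Local Open Scope ring_scope.
Local Open Scope complex_scope.

(* Integers >= h, as a subtype of nat: all uses have h > 0. *)
Definition Zge (h : nat) : Type := {k : nat | (h <= k)%N}.

(* The filter "k -> oo" on Zge h, generated by the tails {k | N <= k}. *)
Definition Zge_infty (h : nat) : set_system (Zge h) :=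
  filter_from setT (fun N : nat => [set k : Zge h | (N <= val k)%N]).
Arguments Zge_infty h : clear implicits.

Global Instance Zge_infty_filter (h : nat) : ProperFilter (Zge_infty h).
Proof.
apply: filter_from_proper.
  apply: filter_fromT_filter; first by exists 0%N.
  move=> i j; exists (maxn i j) => k /=.
  by rewrite geq_max => /andP.
by move=> N _; exists (exist _ (maxn h N) (leq_maxl h N)); exact: leq_maxr.
Qed.

(* Canonical, so that the Landau notations recognize the filter. *)
Canonical Zge_infty_filter_on (h : nat) :=
  FilterType (Zge_infty h) (@filter_filter _ _ (Zge_infty_filter h)).

(* exp(i x) *)
Definition cexpi (R : realType) (x : R) : R[i] := cos x +i* sin x.

(* R[i]^o is R[i] as a normed module over itself, the codomain required by the
   Landau notations. *)
Definition asymptotic_sequence (R : realType) (h : nat)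
    (phi : nat -> Zge h -> R[i]^o) : Prop :=
  (forall m, phi m.+1 =o_ (Zge_infty h) phi m) /\
  (forall m, \forall k \near Zge_infty h, phi m k != 0).

Definition unit_freq (R : realType) : Type := {q : R | 0 <= q < 1}.

(* The data (M, (q_j), (c_m^j)) is the list of the M pairs (q_j, m |-> c_m^j). *)
Definition gp_term (R : realType) : Type := (unit_freq R * (nat -> R[i]))%type.
Definition gp_data (R : realType) : Type := seq (gp_term R).

Definition gp_sum (R : realType) (h : nat) (phi : nat -> Zge h -> R[i]^o)
    (E : gp_data R) (N : nat) (k : Zge h) : R[i]^o :=
  \sum_(t <- E) cexpi (2 * pi * (val k)%:R * val t.1) *
                \sum_(m < N.+1) t.2 m * phi m k.

Definition is_gp_expansion (R : realType) (h : nat) (phi : nat -> Zge h -> R[i]^o)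
    (f : Zge h -> R[i]^o) (E : gp_data R) : Prop :=
  forall N : nat, f = gp_sum phi E N +o_ (Zge_infty h) phi N.

Definition gp_trivial_term (R : realType) (t : gp_term R) : Prop :=
  forall m, t.2 m = 0.

Definition gp_trivial (R : realType) (E : gp_data R) : Prop :=
  List.Forall (@gp_trivial_term R) E.

Inductive gp_step (R : realType) : gp_data R -> gp_data R -> Prop :=
| gp_interchange s1 t s2 u s3 :
    gp_step (s1 ++ t :: s2 ++ u :: s3) (s1 ++ u :: s2 ++ t :: s3)
| gp_remove s1 t s2 :
    gp_trivial_term t -> gp_step (s1 ++ t :: s2) (s1 ++ s2)
| gp_collect s1 q c s2 d s3 :
    gp_step (s1 ++ (q, c) :: s2 ++ (q, d) :: s3)
            (s1 ++ (q, fun m => c m + d m) :: s2 ++ s3).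

(* The symmetric closure accounts for adding zero terms and for undoing a
   collection; expansions are identified up to the generated equivalence. *)
Definition gp_equiv (R : realType) : gp_data R -> gp_data R -> Prop :=
  clos_refl_sym_trans (gp_data R) (@gp_step R).

(* Main.v *)
(** An expansion matters up to equivalence only through the total coefficient
    [C(q, m)] of each frequency [q]: collecting terms and inserting zero terms
    brings any expansion to the list of the [(q, C(q, _))] over any prescribed
    finite set of frequencies containing its own. For two expansions of [f],
    induction on [N] gives [C1(q, N) = C2(q, N)]: subtracting the two expansions
    to order [N], and dividing by [phi_N], yields
    [\sum_q (C1(q, N) - C2(q, N)) e^(2 pi i k q) -> 0], and an exponential sum
    [\sum_q a_q z_q^k] with distinct [z_q] of modulus one tends to [0] only if
    every [a_q] vanishes. *)

Require Import Defs.
From mathcomp Require Import all_boot all_order all_algebra.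
From mathcomp Require Import complex.
From mathcomp Require Import all_classical all_reals all_analysis.
From mathcomp Require Import ring lra.
From Stdlib Require Import Relation_Operators.
Import Order.TTheory GRing.Theory Num.Theory numFieldNormedType.Exports.
Local Open Scope ring_scope.

Set Implicit Arguments.
Unset Strict Implicit.
Unset Printing Implicit Defensive.

(** A fixed linear combination of shifts of the sum is eventually as small as desired. The
    combination given by a polynomial [p] with roots at every [z t] except [z t0] has constant
    modulus [|a t0 * p.[z t0]|], and [p.[z t0]] is nonzero because [z] is injective on [s]. *)
Lemma exp_sum_small_coef0 (F : numFieldType) (T : eqType) (s : seq T)
    (z a : T -> F) :
  uniq s -> {in s &, injective z} -> {in s, forall t, `|z t| = 1} ->
  (forall eps : F, 0 < eps -> exists K : nat, forall k : nat, (K <= k)%N ->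
    `|\sum_(t <- s) z t ^+ k * a t| <= eps) ->
  {in s, forall t, a t = 0}.
Proof.
move=> us zinj z1 small t0 t0s; apply/eqP/negP => /negP at0.
pose p := \prod_(t <- rem t0 s) ('X - (z t)%:P).
have p0 : p.[z t0] != 0.
  rewrite /p horner_prod prodf_seq_neq0; apply/allP => t tr /=.
  rewrite hornerXsubC subr_eq0; apply/eqP => /zinj e.
  move: tr; rewrite (mem_rem_uniq _ us) !inE => /andP[/eqP nt ts].
  by apply: nt; rewrite e.
(* Applying [p] to the shift operator kills every frequency except [z t0]. *)
have filtered k : \sum_(i < size p) p`_i * \sum_(t <- s) z t ^+ (k + i) * a t
    = z t0 ^+ k * a t0 * p.[z t0].
  transitivity (\sum_(t <- s) z t ^+ k * a t * p.[z t]).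
    under eq_bigr => i _ do rewrite mulr_sumr.
    rewrite exchange_big; apply: eq_bigr => t _.
    by rewrite horner_coef mulr_sumr; apply: eq_bigr => i _; rewrite exprD; ring.
  rewrite (big_rem t0) //= [X in _ + X]big_seq big1 ?addr0 //.
  move=> t tr; apply/eqP; rewrite mulf_eq0; apply/orP; right.
  rewrite /p horner_prod prodf_seq_eq0.
  by apply/hasP; exists t => //=; rewrite hornerXsubC subrr.
pose B := \sum_(i < size p) `|p`_i|.
have B0 : 0 <= B by apply: sumr_ge0.
have B1 : 0 < B + 1 by rewrite ltr_wpDl.
pose c := `|a t0 * p.[z t0]|.
have c0 : 0 < c by rewrite normr_gt0 mulf_neq0.
(* At this precision the filtered sum is at most [c * B / (B + 1)], strictly less than its modulus
   [c]; the added 1 also covers [B = 0]. *)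
have [K small_c] := small (c / (B + 1)) (divr_gt0 c0 B1).
have : c <= c / (B + 1) * B.
  have {1}-> : c = `|z t0 ^+ K * a t0 * p.[z t0]|.
    by rewrite -mulrA normrM normrX z1 // expr1n mul1r.
  rewrite -filtered [leRHS]mulr_sumr; apply: le_trans (ler_norm_sum _ _ _) _.
  apply: ler_sum => i _; rewrite normrM [leLHS]mulrC ler_wpM2r //.
  by apply: small_c; rewrite leq_addr.
by rewrite -mulrA ler_pMr // ler_pdivlMl // mulr1 gerDl ler10.
Qed.

Lemma cexpi_mulrn (R : realType) (x : R) (k : nat) :
  cexpi (k%:R * x) = cexpi x ^+ k.
Proof.
elim: k => [|k IH]; first by rewrite mul0r expr0 /cexpi cos0 sin0.
rewrite exprS -IH -natr1 mulrDl mul1r addrC /cexpi cosD sinD.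
by apply/eqP; rewrite eq_complex /= eqxx addrC [cos x * _ + _]addrC eqxx.
Qed.

Lemma norm_cexpi (R : realType) (x : R) : `|cexpi x| = 1.
Proof. by rewrite normc_def /= cos2Dsin2 sqrtr1. Qed.

(** If the values at [x < y] agree, the cosine of the difference of the angles is 1. By the
    double-angle formula the sine of half that difference is 0, but [pi * (y - x)] lies strictly
    between 0 and [pi]. *)
Lemma cexpi_unit_freq_inj (R : realType) :
  injective (fun q : unit_freq R => cexpi (2 * pi * val q)).
Proof.
suff lem (x y : R) : 0 <= x -> x < y -> y < 1 ->
    cexpi (2 * pi * x) != cexpi (2 * pi * y).
  move=> [x /= hx] [y /= hy] /eqP exy; apply: val_inj => /=.
  have [/andP[x0 x1] /andP[y0 y1]] := (hx, hy).
  by case: (ltgtP x y) => // [/lem|/lem]; [move/(_ x0 y1)|move/(_ y0 x1)];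
    rewrite 1?[_ == _]eq_sym ?exy // eq_sym exy.
move=> x0 xy y1; apply/eqP => -[ec es].
have : cos (2 * pi * y - 2 * pi * x) = 1 by rewrite cosB ec es -!expr2 cos2Dsin2.
have -> : 2 * pi * y - 2 * pi * x = (pi * (y - x)) *+ 2 by rewrite mulr2n; ring.
rewrite cos_mulr2n => h.
have pi0 := pi_gt0 R.
have : 0 < sin (pi * (y - x)).
  by apply: sin_gt0_pi; rewrite ?inE; nra.
move: h (cos2Dsin2 (pi * (y - x))); rewrite -mulr_natr => h1 h2 h3.
nra.
Qed.

Lemma gp_equiv_cons (R : realType) (t : gp_term R) (E E' : gp_data R) :
  gp_equiv E E' -> gp_equiv (t :: E) (t :: E').
Proof.
elim=> [A B st|A|A B _|A B C _ IH1 _ IH2].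
- apply: rst_step; case: st => [s1 x s2 y s3|s1 x s2 x0|s1 q c s2 d s3].
  + exact: (gp_interchange (t :: s1)).
  + exact: (gp_remove (t :: s1)).
  + exact: (gp_collect (t :: s1)).
- exact: rst_refl.
- exact: rst_sym.
- exact: rst_trans IH1 IH2.
Qed.

Lemma gp_equiv_move (R : realType) (t : gp_term R) (A B : gp_data R) :
  gp_equiv (t :: A ++ B) (A ++ t :: B).
Proof.
pose z : gp_term R := (t.1, fun _ => 0).
have z0 : gp_trivial_term z by [].
(* Insert a zero term at the target position and interchange it with [t]. *)
apply: (rst_trans _ _ _ (t :: A ++ z :: B)).
  by apply: rst_sym; apply: rst_step; exact: (gp_remove (t :: A)).
apply: (rst_trans _ _ _ (z :: A ++ t :: B)).
  by apply: rst_step; exact: (gp_interchange [::] t A z B).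
by apply: rst_step; exact: (gp_remove [::]).
Qed.

(** The total coefficient [C(q, m)], which is 0 at a frequency absent from [E]. *)
Definition freq_coef (R : realType) (E : gp_data R) (q : unit_freq R)
    (m : nat) : R[i] :=
  \sum_(t <- E | t.1 == q) t.2 m.

Lemma gp_equiv_freq_coef (R : realType) (E : gp_data R)
    (s : seq (unit_freq R)) :
  uniq s -> {subset map fst E <= s} ->
  gp_equiv E [seq (q, freq_coef E q) | q <- s].
Proof.
move=> us; elim: E => [_|[q c] E IH sub].
  (* For empty [E], the list over [s] consists of zero terms, removed one by one. *)
  elim: s {us} => [|q s IHs]; first exact: rst_refl.
  apply: rst_trans IHs _; apply: rst_sym; apply: rst_step.
  by apply: (gp_remove [::]) => m /=; rewrite /freq_coef big_nil.
have qs : q \in s by apply: sub; rewrite inE eqxx.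
have {}IH : gp_equiv E [seq (q, freq_coef E q) | q <- s].
  by apply: IH => x xE; apply: sub; rewrite inE xE orbT.
apply: rst_trans (gp_equiv_cons _ IH) _.
(* As [s] has no repetition, [q] has a single entry: the new term is moved next to it and collected,
   and all other entries are unchanged. *)
case/splitPr: qs us {IH sub} => s1 s2.
rewrite cat_uniq /= negb_or => /and3P[_ /andP[qs1 _] /andP[qs2 _]].
have coef_neq r : q \notin r -> [seq (x, freq_coef ((q, c) :: E) x) | x <- r]
    = [seq (x, freq_coef E x) | x <- r].
  move=> qr; apply/eq_in_map => x xr; congr pair; apply/funext => m.
  rewrite /freq_coef big_cons /=; case: eqP => // qx.
  by move: qr; rewrite qx xr.
rewrite !map_cat /= !coef_neq //.
apply: rst_trans (gp_equiv_move _ _ _) _.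
have -> : freq_coef ((q, c) :: E) q = fun m => c m + freq_coef E q m.
  by apply/funext => m; rewrite /freq_coef big_cons /= eqxx.
by apply: rst_step; exact: (gp_collect _ q c [::]).
Qed.

Lemma gp_sum_freq_coef (R : realType) (h : nat) (phi : nat -> Zge h -> R[i]^o)
    (E : gp_data R) (s : seq (unit_freq R)) (N : nat) (k : Zge h) :
  uniq s -> {subset map fst E <= s} ->
  gp_sum phi E N k =
  \sum_(q <- s) cexpi (2 * pi * (val k)%:R * val q) *
                \sum_(m < N.+1) freq_coef E q m * phi m k.
Proof.
move=> us sub; rewrite /gp_sum.
transitivity (\sum_(q <- s) \sum_(t <- E | t.1 == q)
  cexpi (2 * pi * (val k)%:R * val t.1) * \sum_(m < N.+1) t.2 m * phi m k).
  (* Each term of [E] is counted exactly once, at its own frequency in [s]. *)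
  rewrite (exchange_big_dep xpredT) //= big_seq [RHS]big_seq.
  apply: eq_bigr => t tE; rewrite [RHS]big_mkcond [RHS](bigD1_seq t.1) ?sub ?map_f //=.
  by rewrite eqxx [X in _ + X]big1 ?addr0 // => q; rewrite eq_sym => /negPf ->.
apply: eq_bigr => q _; rewrite mulr_sumr.
under [RHS]eq_bigr => m _ do rewrite /freq_coef mulr_suml mulr_sumr.
rewrite [RHS]exchange_big; apply: eq_bigr => t /eqP <-.
by rewrite mulr_sumr.
Qed.

Lemma gp_expansion_freq_coef_inj (R : realType) (h : nat)
    (phi : nat -> Zge h -> R[i]^o) (f : Zge h -> R[i]^o) (E1 E2 : gp_data R)
    (s : seq (unit_freq R)) :
  (forall m, \forall k \near Zge_infty h, phi m k != 0) ->
  uniq s -> {subset map fst E1 <= s} -> {subset map fst E2 <= s} ->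
  is_gp_expansion phi f E1 -> is_gp_expansion phi f E2 ->
  {in s, forall q m, freq_coef E1 q m = freq_coef E2 q m}.
Proof.
move=> phi0 us sub1 sub2 exp1 exp2 q qs m; move: q qs.
elim/ltn_ind: m => N IH q qs.
apply/eqP; rewrite -subr_eq0; apply/eqP.
pose z (r : unit_freq R) := cexpi (2 * pi * val r).
pose d r := freq_coef E1 r N - freq_coef E2 r N.
apply: (@exp_sum_small_coef0 _ _ s z d) => //.
- by move=> x y _ _; exact: cexpi_unit_freq_inj.
- by move=> x _; exact: norm_cexpi.
move=> eps eps0.
have e20 : 0 < eps / 2 by rewrite divr_gt0.
have /eqaddoP/(_ _ e20) near1 := exp1 N.
have /eqaddoP/(_ _ e20) near2 := exp2 N.
have : \forall k \near Zge_infty h,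
    `|\sum_(t <- s) z t ^+ (val k) * d t| <= eps.
  near=> k.
  have phik : phi N k != 0 by near: k; exact: phi0.
  rewrite -(ler_pM2r (_ : 0 < `|phi N k|)) ?normr_gt0 // -normrM.
  (* In the difference of the two remainders [f] cancels, and so do the orders below [N] by
     induction; only order [N] is left. *)
  have -> : (\sum_(t <- s) z t ^+ (val k) * d t) * phi N k =
      (f - gp_sum phi E2 N) k - (f - gp_sum phi E1 N) k.
    rewrite !fctE (gp_sum_freq_coef phi N k us sub1).
    rewrite (gp_sum_freq_coef phi N k us sub2).
    rewrite opprB [RHS]addrC addrA subrK -sumrB mulr_suml.
    apply: eq_big_seq => r rs.
    rewrite -mulrBr -mulrA; congr (_ * _).
      by rewrite /z -cexpi_mulrn; congr cexpi; ring.
    rewrite !big_ord_recr /= opprD addrACA -mulrBl.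
    rewrite (eq_bigr (fun i : 'I_N => freq_coef E2 r i * phi i k)).
      by rewrite subrr add0r.
    by move=> i _; rewrite (IH i).
  rewrite [eps]splitr mulrDl; apply: le_trans (ler_normB _ _) _.
  apply: lerD; near: k; [exact: near2|exact: near1].
(* The maximum with [h] ensures that [k] is a point of [Zge h]. *)
move=> [K _ small]; exists (maxn h K) => k; rewrite geq_max => /andP[hk Kk].
exact: (small (exist _ k hk)).
Unshelve. all: by end_near.
Qed.

Theorem theorem2p3 (R : realType) (h : nat) (hpos : (0 < h)%N)
    (phi : nat -> Zge h -> R[i]^o) (phi_asym : asymptotic_sequence phi) :
  (forall (f : Zge h -> R[i]^o) (E1 E2 : gp_data R),
      is_gp_expansion phi f E1 -> is_gp_expansion phi f E2 ->
      gp_equiv E1 E2) /\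
  (forall E : gp_data R,
      is_gp_expansion phi (fun _ => 0) E ->
      exists E0 : gp_data R, gp_trivial E0 /\ gp_equiv E E0).
Proof.
have unique (f : Zge h -> R[i]^o) (E1 E2 : gp_data R) :
    is_gp_expansion phi f E1 -> is_gp_expansion phi f E2 -> gp_equiv E1 E2.
  move=> exp1 exp2.
  (* A common list of frequencies makes both normal forms comparable entry by entry. *)
  pose s := undup (map fst E1 ++ map fst E2).
  have us : uniq s by exact: undup_uniq.
  have sub1 : {subset map fst E1 <= s}.
    by move=> q qE; rewrite mem_undup mem_cat qE.
  have sub2 : {subset map fst E2 <= s}.
    by move=> q qE; rewrite mem_undup mem_cat qE orbT.
  apply: rst_trans (gp_equiv_freq_coef us sub1) _.
  apply: rst_sym; apply: rst_trans (gp_equiv_freq_coef us sub2) _.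
  suff -> : [seq (q, freq_coef E2 q) | q <- s] =
      [seq (q, freq_coef E1 q) | q <- s].
    exact: rst_refl.
  apply/eq_in_map => q qs; congr pair; apply/funext => m; apply/esym.
  exact: (gp_expansion_freq_coef_inj (proj2 phi_asym) us sub1 sub2 exp1 exp2).
(* The empty expansion represents the zero function with zero remainder, so uniqueness applies to it
   and [E]. *)
split=> // E expE; exists [::]; split; first exact: List.Forall_nil.
apply: unique expE _ => N; apply/eqaddoP => eps eps0.
apply: nearW => k /=.
by rewrite !fctE /gp_sum big_nil subr0 normr0 mulr_ge0 // ltW.
Qed.
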